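(* Let $\{u^n\}_{n\ge0}$ be a sequence generated by the forward-backward splitting iteration described in the context, and let $u^*$ be a minimizer of $F+\Phi$ over $X$. If $\Phi$ is $q$-convex in $u^*$ for some $q\in[2,\infty)$, then $u^*$ is the unique minimizer of $F+\Phi$ and $\{u^n\}$ converges to $u^*$ with asymptotic rate $n^{(1-p)/q}$, i.e. there is a constant $C>0$ with $$\|u^n-u^*\|_X\le C\,n^{(1-p)/q}\qquad\text{for all } n\ge1 .$$
   Context: Setting. $X$ is a real reflexive Banach space with dual $X^*$ and duality pairing $\langle\cdot,\cdot\rangle$. $F:X\to\mathbb{R}$ and $\Phi:X\to\mathbb{R}\cup\{\infty\}$ are proper, convex and lower semi-continuous, and $F+\Phi$ is coercive, i.e. $(F+\Phi)(u)\to\infty$ as $\|u\|_X\to\infty$. $F$ is differentiable and, for some fixed $1<p\le 2$, its derivative $F':X\to X^*$ is $(p-1)$-Hölder-continuous on each bounded set: for each $R>0$ there is $L>0$ with $\|F'(u)-F'(v)\|_{X^*}\le L\|u-v\|_X^{p-1}$ whenever $\|u\|_X,\|v\|_X\le R$. Iteration. Fix $0<\delta<1$ and $\underline\tau>0$, and start with $u^0\in X$, $\Phi(u^0)<\infty$. Given $u^n$, let $L_n>0$ (denoted $\|F'\|_{p-1}$) be a $(p-1)$-Hölder constant of $F'$ on a ball $\{\|u\|_X\le C_n\}$ such that $\|u\|_X\le C_n$ for all $u$ with $(F+\Phi)(u)\le(F+\Phi)(u^n)$ (one may keep $L_{n}=L_{n-1}$). Set $w^n=F'(u^n)$, choose $\tau_n$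 with $0<\underline\tau\le\tau_n\le p(1-\delta)/L_n$, and let $u^{n+1}$ be a solution of $$\min_{v\in X}\ \frac{\|v-u^n\|_X^p}{p}+\tau_n\bigl(\langle w^n,v\rangle+\Phi(v)\bigr)$$ which minimizes $\|v-u^n\|_X$ among all solutions $v$. (Stopping at an optimal iterate corresponds to the sequence staying constant from then on.) Definition. A proper, convex and lower semi-continuous $\Phi:X\to\mathbb{R}\cup\{\infty\}$ is convex of power-type $q$ (or $q$-convex) in $u^*\in X$, with $q\in[2,\infty)$, if for all $M>0$ and $w\in\partial\Phi(u^* )$ there exists $c>0$ such that for all $u\in X$ with $\|u-u^*\|_X\le M$: $\Phi(u)-\Phi(u^* )-\langle w,u-u^*\rangle\ge c\|u-u^*\|_X^q$. *)

(* Defs.v *)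
From HB Require Import structures.
From mathcomp Require Import all_boot all_order all_algebra.
From mathcomp Require Import all_classical all_reals all_analysis.

Set Implicit Arguments.
Unset Strict Implicit.
Unset Printing Implicit Defensive.
Import Order.TTheory GRing.Theory Num.Theory.
Import numFieldNormedType.Exports.
Local Open Scope classical_set_scope.
Local Open Scope ring_scope.

(* The topological dual X^* of continuous linear functionals on X, as a normed
   module for the operator norm; the pairing <w, x> is the application w x. *)
Section Dual.
Variables (R : realType) (X : normedModType R).

Definition dual_mem : {pred X -> R^o} :=
  [pred f | `[< linear f /\ continuous f >]].

Record dual := Dual { dual_fun :> X -> R^o ; dual_funP : dual_fun \in dual_mem }.

HB.instance Definition _ := [isSub for dual_fun].
HB.instance Definition _ := [Choice of dual by <:].

Lemma dual_memP (f : X -> R^o) :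
  reflect (linear f /\ continuous f) (f \in dual_mem).
Proof. exact: asboolP. Qed.

Lemma dual_submod_closed : submod_closed dual_mem.
Proof.
split.
  apply/dual_memP; split; last by move=> x; exact: cvg_cst.
  by move=> a x y /=; rewrite scaler0 addr0.
move=> a f g /dual_memP[lf cf] /dual_memP[lg cg]; apply/dual_memP; split.
  move=> k x y; rewrite /= !fctE lf lg scalerDr !scalerA (mulrC a k).
  by rewrite -!scalerA scalerDr addrACA.
move=> x; apply: (@cvgD _ _ _ _ _ (a *: f) g); last exact: cg.
by apply: cvgZl_tmp; exact: cf.
Qed.

HB.instance Definition _ :=
  GRing.isSubmodClosed.Build R (X -> R^o) dual_mem dual_submod_closed.
HB.instance Definition _ := [SubChoice_isSubLmodule of dual by <:].

Lemma dual_linear (f : dual) : linear f.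
Proof. by have /dual_memP[] := dual_funP f. Qed.

HB.instance Definition _ (f : dual) :=
  GRing.isLinear.Build R X R^o *:%R (dual_fun f) (@dual_linear f).

Lemma dual_continuous (f : dual) : continuous f.
Proof. by have /dual_memP[] := dual_funP f. Qed.

Lemma dualP (f g : dual) : f =1 g -> f = g.
Proof. by move=> fg; apply/val_inj/funext. Qed.

Definition dual_norm (f : dual) : R :=
  sup [set `|f x| | x in [set x : X | `|x| <= 1]].

Lemma dual_norm_has_sup (f : dual) :
  has_sup [set `|f x| | x in [set x : X | `|x| <= 1]].
Proof.
split; first by exists `|f 0|, 0 => //=; rewrite normr0.
have /bounded_funP/(_ 1)[M fM] :=
  @continuous_linear_bounded _ _ _ 0 f (@dual_continuous f 0).
by exists M => _ [x x1 <-]; exact: fM.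
Qed.

Lemma dual_norm_ub (f : dual) x : `|x| <= 1 -> `|f x| <= dual_norm f.
Proof.
by move=> x1; apply: ub_le_sup; [case: (dual_norm_has_sup f)|exists x].
Qed.

Lemma dual_norm_le (f : dual) M :
  (forall x, `|x| <= 1 -> `|f x| <= M) -> dual_norm f <= M.
Proof.
move=> fM; apply: ge_sup; first by case: (dual_norm_has_sup f).
by move=> _ [x x1 <-]; exact: fM.
Qed.

Lemma dual_normD (f g : dual) :
  dual_norm (f + g) <= dual_norm f + dual_norm g.
Proof.
apply: dual_norm_le => x x1; apply: le_trans (ler_normD (f x) (g x)) _.
by rewrite lerD// dual_norm_ub.
Qed.

Lemma dual_normZ_le (a : R) (f : dual) :
  dual_norm (a *: f) <= `|a| * dual_norm f.
Proof.
by apply: dual_norm_le => x x1; rewrite normrM ler_wpM2l// dual_norm_ub.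
Qed.

Lemma dual_normZ (a : R) (f : dual) :
  dual_norm (a *: f) = `|a| * dual_norm f.
Proof.
apply/eqP; rewrite eq_le dual_normZ_le /=.
have [->|a0] := eqVneq a 0.
  rewrite normr0 mul0r; apply: le_trans (dual_norm_ub _ (x := 0) _) => //.
  by rewrite normr0.
rewrite -{1}(scalerK a0 f) mulrC -ler_pdivlMr ?normr_gt0// mulrC -normfV.
exact: dual_normZ_le.
Qed.

Lemma dual_norm_eq0 (f : dual) : dual_norm f = 0 -> f = 0.
Proof.
move=> f0; apply: dualP => x; apply/eqP.
have [->|x0] := eqVneq x 0; first by rewrite linear0.
have := @dual_norm_ub f (`|x|^-1 *: x); rewrite normfZV// lexx f0 => /(_ isT).
rewrite linearZ normrM mulrC pmulr_lle0 ?normr_gt0 ?invr_eq0 ?normr_eq0//.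
by rewrite normr_le0.
Qed.

HB.instance Definition _ :=
  @Lmodule_isNormed.Build R dual dual_norm dual_normD dual_normZ dual_norm_eq0.

End Dual.

Definition reflexive_space (R : realType) (X : normedModType R) :=
  forall phi : dual (dual X), exists x : X, forall f : dual X, phi f = f x.

Section ExtendedRealFunctionals.
Variables (R : realType) (X : normedModType R).
Implicit Types (f : X -> \bar R) (u v w : X).
Local Open Scope ereal_scope.

Definition proper_fun f := (forall u, -oo < f u) /\ (exists u, f u < +oo).

(* Only used for f with no value -oo, so the right-hand side is never of the
   form +oo - oo; as 0 * +oo = 0, the cases t = 0 and t = 1 are harmless. *)
Definition ereal_convex f := forall u v (t : R), (0 <= t <= 1)%R ->
  f (t *: u + (1 - t) *: v)%R <= t%:E * f u + (1 - t)%:E * f v.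

Definition proper_convex_lsc f :=
  [/\ proper_fun f, ereal_convex f & lower_semicontinuous f].

Definition coercive f :=
  forall A : R, exists B : R, forall u, (B <= `|u|)%R -> A%:E <= f u.

Definition minimizer f u := forall v, f u <= f v.

Definition subdifferential f u : set (dual X) :=
  [set w | forall v, f u + (w (v - u)%R)%:E <= f v].

Definition q_convex (q : R) f u := forall (M : R) (w : dual X),
  (0 < M)%R -> subdifferential f u w -> exists2 c : R, (0 < c)%R &
    forall v, (`|v - u| <= M)%R ->
      (c * `|v - u| `^ q)%:E <= f v - f u - (w (v - u)%R)%:E.

End ExtendedRealFunctionals.

Section ForwardBackward.
Variables (R : realType) (X : normedModType R).
Implicit Types (F : X -> R) (dF : X -> dual X) (Phi : X -> \bar R).

Definition holder_on_ball dF (s L C : R) := forall u v : X,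
  `|u| <= C -> `|v| <= C -> `|dF u - dF v| <= L * `|u - v| `^ s.

Definition objective F Phi : X -> \bar R := fun v => ((F v)%:E + Phi v)%E.

Definition prox_objective Phi (p tau : R) (w : dual X) (u : X) : X -> \bar R :=
  fun v => ((`|v - u| `^ p / p)%:E + tau%:E * ((w v)%:E + Phi v))%E.

Definition closest_minimizer (f : X -> \bar R) (u v : X) :=
  minimizer f v /\ forall v', minimizer f v' -> `|v - u| <= `|v' - u|.

Definition fb_step F dF Phi (p delta tau_min : R) (u u' : X) :=
  exists L C tau : R,
    [/\ 0 < L,
        forall v, (objective F Phi v <= objective F Phi u)%E -> `|v| <= C,
        holder_on_ball dF (p - 1) L C,
        tau_min <= tau <= p * (1 - delta) / L &
        closest_minimizer (prox_objective Phi p tau (dF u) u) u u'].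

(* The second alternative encodes stopping at an optimal iterate: the sequence
   stays constant and no step size has to be chosen any more. *)
Definition fb_sequence F dF Phi (p delta tau_min : R) (u : nat -> X) :=
  (Phi (u 0%N) < +oo)%E /\
  forall n, fb_step F dF Phi p delta tau_min (u n) (u n.+1) \/
            (minimizer (objective F Phi) (u n) /\ u n.+1 = u n).

End ForwardBackward.

(* Main.v *)
Require Import Defs.
From HB Require Import structures.
From mathcomp Require Import all_boot all_order all_algebra.
From mathcomp Require Import all_classical all_reals all_analysis.
From mathcomp Require Import ring lra.

Set Implicit Arguments.
Unset Strict Implicit.
Unset Printing Implicit Defensive.
Import Order.TTheory GRing.Theory Num.Theory.
Import numFieldNormedType.Exports.
Local Open Scope classical_set_scope.
Local Open Scope ring_scope.

(* Write J = F + Phi, z for the minimizer ustar, r_n = J(u_n) - J(z),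
   h = u_{n+1} - u_n and D = Phi(u_n) - Phi(u_{n+1}) - <F'(u_n), h>.  Minimality
   of u_{n+1} on the segment [u_n, u_{n+1}] gives |h|^p <= tau_n D, which with the
   Hoelder estimate F(u_{n+1}) <= F(u_n) + <F'(u_n), h> + (L/p) |h|^p and
   tau_n <= p (1 - delta) / L yields J(u_{n+1}) <= J(u_n) - delta D.  Minimality
   compared with the segment [u_n, z] gives D >= t r_n - K t^p for t in [0, 1],
   with K independent of n as the iterates are bounded; taking t proportional to
   r_n^{1/(p-1)} yields r_{n+1} <= r_n - a r_n^{1+s} with s = 1/(p-1) >= 1, whence
   r_n = O(n^{1-p}).  Finally -F'(z) is a subgradient of Phi at z, so q-convexity
   of Phi and convexity of F give c |v - z|^q <= J(v) - J(z). *)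

(** * One-sided slopes and directional derivatives *)

Section Slopes.
Variables (R : realType) (V : normedModType R).

(** The two-sided limit defining the derivative is also the limit of the difference quotients as [t]
    tends to 0 from the right, and these are at least [a]. *)
Lemma slope_ge_derive (f : V -> R^o) (x v : V) (df : R^o) (a : R) :
  is_derive x v f df ->
  (forall t, 0 < t <= 1 -> f x + t * a <= f (x + t *: v)) -> a <= df.
Proof.
move=> [der <-] fa.
have der' : (fun h : R => h^-1 *: ((f \o shift x) (h *: v) - f x)) @ 0^'+
    --> 'D_v f x.
  apply: (cvg_trans _ der); apply: cvg_app.
  by apply: within_subset => r /= /gt_eqF->.
apply: (cvgr_to_ge der'); near=> t.
have t0 : 0 < t by [].
rewrite /GRing.scale/= mulrC ler_pdivlMr// lerBrDl (addrC _ x) mulrC fa//.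
by rewrite t0/=; near: t; exact: nbhs_right_le.
Unshelve. all: by end_near. Qed.

Lemma slope_le_derive (f : V -> R^o) (x v : V) (df : R^o) (a : R) :
  is_derive x v f df ->
  (forall t, 0 < t <= 1 -> f (x + t *: v) <= f x + t * a) -> df <= a.
Proof.
move=> fdf fa; rewrite -lerN2.
apply: (@slope_ge_derive (- f) x v (- df) (- a)) => t t01.
by rewrite !fctE mulrN -opprD lerN2 fa.
Qed.

Lemma diff_is_derive (f : V -> R^o) (df : V -> R^o) (x v : V) :
  is_diff x f df -> is_derive x v f (df v).
Proof.
move=> [dfx <-]; rewrite -deriveE//.
by apply: derivableP; exact: diff_derivable.
Qed.

Lemma is_derive_line (f : V -> R^o) (x v : V) (s df : R) :
  is_derive (x + s *: v) v f df ->
  is_derive s 1 (fun r : R => f (x + r *: v) : R^o) df.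
Proof.
move=> [der <-].
have E : (fun h : R => h^-1 *:
      (((fun r : R => f (x + r *: v)) \o shift s) (h *: 1) - f (x + s *: v)))
   = (fun h : R => h^-1 *: ((f \o shift (x + s *: v)) (h *: v) - f (x + s *: v))).
  apply/funext => h /=; congr (_ *: (f _ - _)).
  by rewrite [h *: _]mulr1 scalerDl addrCA.
by split; rewrite /derivable /derive E.
Qed.

End Slopes.

(** Both sides equal 1 at [t = 0], so their right derivatives there, [- a] and [- p], are ordered
    the same way. *)
Lemma powR_affine_minorant_slope (R : realType) (p a : R) :
  (forall t : R, 0 < t <= 1 -> 1 - t * a <= (1 - t) `^ p) -> p <= a.
Proof.
move=> pa.
have d1 : derivable (@powR R ^~ p) 1 1.
  by apply: derivable_powR; rewrite in_itv/= ltr01.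
have df1 : differentiable (@powR R ^~ p : R -> R^o) (1 : R).
  by apply/derivable1_diffP.
have dN : derivable (@powR R ^~ p : R -> R^o) (1 : R) (-1 : R).
  by exact: diff_derivable.
have := derivableP dN; rewrite deriveE//.
rewrite linearN -deriveE//.
have [_ ->] := is_derive1_powR p (@ltr01 R); rewrite powR1 mulr1 => /slope_ge_derive.
move=> /(_ (- a)); rewrite lerN2; apply => t t01.
rewrite powR1 mulrN; apply: le_trans (pa t t01) _.
by rewrite /GRing.scale/= mulrN1.
Qed.

(** * The Hoelder descent estimate *)

Lemma dual_le_norm (R : realType) (X : normedModType R) (f : dual X) (x : X) :
  `|f x| <= `|f| * `|x|.
Proof.
have [->|x0] := eqVneq x 0; first by rewrite linear0 normr0 mulr_ge0.
have := @dual_norm_ub _ _ f (`|x|^-1 *: x); rewrite normfZV// lexx => /(_ isT).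
by rewrite linearZ normrM normfV normr_id mulrC ler_pdivrMr ?normr_gt0.
Qed.

Lemma continuous_within_powR (R : realType) (p : R) : 0 < p ->
  {within `[0, 1], continuous (@powR R ^~ p)}.
Proof.
move=> p0; apply/continuous_within_itvP; first exact: ltr01.
have c x : 0 < x -> {for x, continuous (@powR R ^~ p)}.
  move=> x0; apply: differentiable_continuous; apply/derivable1_diffP.
  by apply: derivable_powR; rewrite in_itv/= x0.
split.
- by move=> x; rewrite in_itv/= => /andP[x0 _]; exact: c.
- by rewrite powR0 ?gt_eqF//; exact: powR_cvg0.
- by apply: cvg_at_left_filter; exact: c.
Qed.

(** The mean value theorem for [F (u + r k) - r F'(u) k - (L/p) |k|^p r^p] on [0, 1] takes the place
    of integrating the derivative. The segment lies in the ball, so the Hoelder bound makes the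
    derivative of this function at most 0 inside the interval. *)
Lemma holder_descent (R : realType) (X : normedModType R) (F : X -> R^o)
    (dF : X -> dual X) (p L C : R) (u k : X) :
  1 < p -> (forall x, is_diff x F (dF x)) -> holder_on_ball dF (p - 1) L C ->
  `|u| <= C -> `|u + k| <= C ->
  F (u + k) <= F u + dF u k + L / p * `|k| `^ p.
Proof.
move=> p1 hF hL uC ukC.
have p0 : 0 < p by rewrite (lt_trans _ p1).
pose f1 := (fun r : R => F (u + r *: k) : R^o).
pose f2 := (fun r : R => r * dF u k : R^o).
pose f3 := (@powR R ^~ p : R -> R^o).
pose b := L / p * `|k| `^ p.
pose g : R -> R^o := f1 - f2 - (b *: f3).
have df1 (s : R) : is_derive s (1 : R) f1 (dF (u + s *: k) k).
  by apply: is_derive_line; exact: diff_is_derive.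
have df2 (s : R) : is_derive s (1 : R) f2 (dF u k).
  have -> : f2 = dF u k \*: (@id R : R -> R^o).
    by apply/funext => r; rewrite /f2 /= mulrC.
  apply: is_derive_eq; by rewrite /GRing.scale/= mulr1.
pose dg s := dF (u + s *: k) k - dF u k - b * (p * s `^ (p - 1)).
have gd (s : R) : s \in `]0, 1[ -> is_derive s (1 : R) g (dg s).
  rewrite in_itv/= => /andP[s0 _].
  have := is_derive1_powR p s0 => d3.
  exact: is_deriveB.
have gc : {within `[0, 1], continuous g}.
  move=> x; apply: continuousB; first apply: continuousB.
  - apply: continuous_subspaceT => s; apply: differentiable_continuous.
    by apply/derivable1_diffP; apply: ex_derive.
  - apply: continuous_subspaceT => s; apply: differentiable_continuous.
    by apply/derivable1_diffP; apply: ex_derive.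
  - apply: continuousZl_tmp; exact: continuous_within_powR.
have [c] := MVT ltr01 gd gc.
rewrite in_itv/= subr0 mulr1 => /andP[c0 c1].
rewrite /g !fctE /f1 /f2 /f3 scale0r addr0 scale1r mul0r mul1r powR1 powR0 ?gt_eqF//.
rewrite /GRing.scale/= mulr0 mulr1 !subr0.
suff : dg c <= 0 by move=> /[swap] <-; rewrite /b; lra.
rewrite /dg subr_le0.
have -> : dF (u + c *: k) k - dF u k = (dF (u + c *: k) - dF u) k by [].
apply: le_trans (ler_norm _) _; apply: le_trans (dual_le_norm _ _) _.
have ckC : `|u + c *: k| <= C.
  have -> : u + c *: k = (1 - c) *: u + c *: (u + k).
    by rewrite scalerBl scale1r scalerDr addrA subrK.
  apply: le_trans (ler_normD _ _) _; rewrite !normrZ !ger0_norm ?subr_ge0 ?(ltW c1) ?(ltW c0)//.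
  have -> : C = (1 - c) * C + c * C by ring.
  by rewrite lerD// ler_wpM2l// ?subr_ge0 ltW.
have /(ler_wpM2r (normr_ge0 k)) := hL _ _ ckC uC.
move=> /le_trans; apply.
rewrite addrAC subrr add0r normrZ ger0_norm ?(ltW c0)// powRM ?(ltW c0)//.
rewrite /b -(mulr_powRB1 (normr_ge0 k) p0) le_eqVlt; apply/orP; left; apply/eqP.
field; exact: lt0r_neq0.
Qed.

(** * One step of the iteration, in real arithmetic *)

Section ConvexSegments.
Variables (R : realType) (X : normedModType R).
Implicit Types (dom : set X) (phi : X -> R).

(** Encodes an extended-valued convex function by its effective domain and its finite values. *)
Definition segment_convex dom phi := forall x y (t : R), dom x -> dom y ->
  0 <= t <= 1 ->
  dom (x + t *: (y - x)) /\ phi (x + t *: (y - x)) <= phi x + t * (phi y - phi x).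

Lemma convex_gradient_le (F : X -> R^o) (dF : X -> dual X) (x y : X) :
  segment_convex setT F -> is_diff x F (dF x) ->
  F x + dF x (y - x) <= F y.
Proof.
move=> cF hF; rewrite -lerBrDl.
apply: (slope_le_derive (diff_is_derive (y - x) hF)) => t /andP[t0 t1].
by apply: (cF x y t I I _).2; rewrite ltW.
Qed.

(** Write [h = u' - u] and [D] for the bracket on the right. Comparing [u'] with [u] alone gives
    only [|h|^p <= p tau D]; comparing it with all points [u + (1 - t) h] and letting [t] tend to 0
    gains the factor [p]. *)
Lemma prox_sufficient_decrease dom phi (w : dual X) (p tau : R) (u u' : X) :
  segment_convex dom phi -> 1 < p -> 0 < tau -> dom u -> dom u' ->
  (forall v, dom v -> `|u' - u| `^ p / p + tau * (w u' + phi u') <=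
                      `|v - u| `^ p / p + tau * (w v + phi v)) ->
  `|u' - u| `^ p <= tau * (phi u - phi u' - w (u' - u)).
Proof.
move=> cphi p1 tau0 du du' hmin.
have p0 : 0 < p by rewrite (lt_trans _ p1).
have [E|h0] := eqVneq (u' - u) 0.
  move: E => /eqP; rewrite subr_eq0 => /eqP ->.
  by rewrite !subrr linear0 subr0 mulr0 normr0 powR0 ?gt_eqF.
have hp0 : 0 < `|u' - u| `^ p by rewrite powR_gt0 ?normr_gt0.
set D := _ - _ - _; set H := `|u' - u| `^ p in hp0 *.
suff : p <= p * (tau * D) / H.
  by rewrite ler_pdivlMr// ler_pM2l.
apply: powR_affine_minorant_slope => t /andP[t0 t1].
have t01 : 0 <= 1 - t <= 1 by rewrite subr_ge0 t1 lerBlDr lerDl ltW.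
have [dv fv] := cphi _ _ _ du du' t01.
have := hmin _ dv.
rewrite [_ - u in leRHS]addrAC subrr add0r normrZ ger0_norm ?subr_ge0//.
rewrite powRM ?subr_ge0// -/H linearD linearZ/= => hm.
have wE : w u' = w u + w (u' - u) by rewrite linearB/=; ring.
rewrite wE in hm.
have tmul := ler_wpM2l (ltW tau0) fv.
have : H / p - (1 - t) `^ p * H / p <= tau * t * D.
  by rewrite /D; move: hm tmul; rewrite /GRing.scale/=; lra.
move=> hh.
rewrite -subr_ge0 -(pmulr_lge0 _ hp0) -(pmulr_lge0 _ (x := p^-1)) ?invr_gt0//.
have -> : ((1 - t) `^ p - (1 - t * (p * (tau * D) / H))) * H / p =
   (1 - t) `^ p * H / p - H / p + tau * t * D.
  by field; rewrite !gt_eqF.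
by lra.
Qed.

(** [u'] is compared with [u + t (v - u)] and the nonnegative term [|u' - u|^p / p] is dropped. The
    parameter [t] stays free, to be chosen according to the energy gap. *)
Lemma prox_gap dom phi (w : dual X) (p tau : R) (u u' v : X) (t : R) :
  segment_convex dom phi -> 1 < p -> 0 < tau -> dom u -> dom v ->
  (forall v, dom v -> `|u' - u| `^ p / p + tau * (w u' + phi u') <=
                      `|v - u| `^ p / p + tau * (w v + phi v)) ->
  0 <= t <= 1 ->
  t * (phi u - phi v - w (v - u)) - t `^ p * (`|v - u| `^ p / (p * tau)) <=
  phi u - phi u' - w (u' - u).
Proof.
move=> cphi p1 tau0 du dv hmin t01.
have p0 : 0 < p by rewrite (lt_trans _ p1).
have /andP[t0 t1] := t01.
have [ds fs] := cphi _ _ _ du dv t01.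
have := hmin _ ds.
rewrite [_ - u in leRHS]addrAC subrr add0r normrZ ger0_norm//.
rewrite powRM// linearD linearZ/= => hm.
have wE : w u' = w u + w (u' - u) by rewrite linearB/=; ring.
rewrite wE in hm.
have tmul := ler_wpM2l (ltW tau0) fs.
have H0 : 0 <= `|u' - u| `^ p / p by rewrite divr_ge0 ?powR_ge0// ltW.
rewrite -(ler_pM2l tau0) mulrBr.
have -> : tau * (t `^ p * (`|v - u| `^ p / (p * tau))) = t `^ p * `|v - u| `^ p / p.
  by field; rewrite !gt_eqF.
by move: hm tmul; rewrite /GRing.scale/=; lra.
Qed.

(* The Hoelder estimate is only available in the ball of radius [C], which is not
   known in advance to contain [u'].  A point of the segment [u, u'] which lies
   in the ball has strictly smaller energy than [u], so by convexity the next
   points still belong to the sublevel set, hence to the ball.  If [u'] were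
   outside the ball, the parameter could always be increased by the same amount. *)
Lemma fb_descent (F : X -> R^o) (dF : X -> dual X) dom phi
    (p tau L C delta : R) (u u' : X) :
  segment_convex setT F -> (forall x, is_diff x F (dF x)) ->
  segment_convex dom phi -> 1 < p -> 0 < tau -> 0 < L -> 0 < delta < 1 ->
  tau <= p * (1 - delta) / L -> dom u -> dom u' ->
  holder_on_ball dF (p - 1) L C ->
  (forall v, dom v -> F v + phi v <= F u + phi u -> `|v| <= C) ->
  `|u' - u| `^ p <= tau * (phi u - phi u' - dF u (u' - u)) ->
  F u' + phi u' <= F u + phi u - delta * (phi u - phi u' - dF u (u' - u)).
Proof.
move=> cF hF cphi p1 tau0 L0 /andP[delta0 delta1] tauL du du' hL hC.
have p0 : 0 < p by rewrite (lt_trans _ p1).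
set h := u' - u; set D := phi u - phi u' - dF u h => hD.
have [h0|h0] := eqVneq h 0.
  move: (h0) => /eqP; rewrite /h subr_eq0 => /eqP E.
  by rewrite /D h0 E linear0 !subrr mulr0 subr0.
have D0 : 0 < D.
  by rewrite -(pmulr_rgt0 _ tau0) (lt_le_trans _ hD)// powR_gt0// normr_gt0.
have LD : L / p * `|h| `^ p <= (1 - delta) * D.
  have := ler_wpM2r (ltW D0) tauL => /(le_trans hD).
  move=> /(ler_wpM2l (ltW (divr_gt0 L0 p0))) /le_trans; apply.
  by rewrite le_eqVlt; apply/orP; left; apply/eqP; field; rewrite !gt_eqF.
pose g t := F (u + t *: h) + phi (u + t *: h).
have dg t : 0 <= t <= 1 -> dom (u + t *: h) by move=> /(cphi _ _ _ du du')[].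
have uC : `|u| <= C by apply: hC.
(* Since [p > 1], [t^p <= t] on [0, 1], so the Hoelder remainder is at most [t (1 - delta) D],
   against a linear decrease of [t D]. *)
have step t : 0 <= t <= 1 -> `|u + t *: h| <= C ->
    g t <= F u + phi u - t * (delta * D).
  move=> t01 tC; have [_ phit] := cphi _ _ _ du du' t01.
  have /andP[t0 t1] := t01.
  have := holder_descent p1 hF hL uC tC.
  rewrite linearZ/= normrZ ger0_norm// powRM// => Ft.
  have tp : t `^ p <= t.
    have [->|tn0] := eqVneq t 0; first by rewrite powR0// gt_eqF.
    by apply: ge1r_powR (ltW p1); rewrite t1 lt_def tn0 t0.
  have : t `^ p * (L / p * `|h| `^ p) <= t * ((1 - delta) * D).
    by apply: ler_pM => //; rewrite ?powR_ge0// mulr_ge0 ?powR_ge0// ltW// divr_gt0.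
  rewrite /g /D -/h; move: Ft phit; rewrite -/h /D /GRing.scale/=; lra.
suff u'C : `|u'| <= C.
  have := step 1; rewrite /g scale1r addrC subrK lexx ler01 mul1r; exact.
rewrite leNgt; apply/negP => u'C.
(* Otherwise all slopes of [F] from [u] along [h] exceed [phi u - phi u'], and their limit yields
   [D <= 0]. *)
have [t0 /andP[t00 t01] gt0] : exists2 t, 0 < t <= 1 & g t <= F u + phi u.
  apply: contrapT => /forall2NP nt; move: D0; rewrite ltNge => /negP; apply.
  rewrite subr_le0.
  apply: (slope_ge_derive (diff_is_derive h (hF u))) => t t01.
  have [//|/negP] := nt t; rewrite -ltNge /g => gt.
  have [|_ phit] := cphi _ _ t du du'; first by case/andP: t01 => /ltW->.
  by move: gt phit; rewrite -/h; lra.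
have G0 : F u + phi u < F u' + phi u'.
  by rewrite ltNge; apply/negP => /(hC _ du'); rewrite leNgt u'C.
pose G := F u' + phi u' - (F u + phi u).
(* Points of [S] have energy at least [d] below that of [u], while [u'] is [G] above it. A chord
   from [- d] to [G] vanishes at the weight [la], which is the same for all points of [S]. *)
pose d := t0 * (delta * D).
have d0 : 0 < d by rewrite /d !mulr_gt0.
have dG0 : 0 < d + G by rewrite addr_gt0// subr_gt0.
pose la := d / (d + G).
have la01 : 0 < la <= 1.
  by rewrite divr_gt0//= ler_pdivrMr// mul1r lerDl subr_ge0 ltW.
pose S := [set t | t0 <= t <= 1 /\ g t <= F u + phi u].
have Snext t : S t -> S (t + la * (1 - t)).
  move=> [/andP[t0t t1] gt]; have /andP[la0 la1] := la01.
  have t0' : 0 <= t by rewrite (le_trans _ t0t)// ltW.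
  have s1 : t + la * (1 - t) <= 1.
    by rewrite -lerBrDl ler_piMl// subr_ge0.
  split.
    by rewrite s1 andbT (le_trans t0t)// lerDl mulr_ge0 ?(ltW la0)// subr_ge0.
  have dt : dom (u + t *: h) by apply: dg; rewrite t0'.
  have la01' : 0 <= la <= 1 by rewrite ltW.
  have E : u + (t + la * (1 - t)) *: h = (u + t *: h) + la *: (u' - (u + t *: h)).
    rewrite opprD addrA -/h scalerDl -scalerA scalerBl scale1r addrA.
    by congr (_ + _).
  have tC : `|u + t *: h| <= C by apply: hC.
  have gt' := step t (introT andP (conj t0' t1)) tC.
  rewrite /g E.
  have [_ Fs] := cF (u + t *: h) u' la I I la01'.
  have [_ ps] := cphi (u + t *: h) u' la dt du' la01'.
  apply: le_trans (lerD Fs ps) _.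
  have tD : d <= t * (delta * D) by rewrite ler_wpM2r// ltW// mulr_gt0.
  have : (1 - la) * g t <= (1 - la) * (F u + phi u - d).
    by rewrite ler_wpM2l ?subr_ge0//; lra.
  have : (1 - la) * d = la * G by rewrite /la; field; rewrite gt_eqF.
  rewrite /g /G; lra.
have Sgap t : S t -> `|u'| - C <= (1 - t) * `|h|.
  move=> [/andP[t0t t1] gt].
  have tC : `|u + t *: h| <= C.
    by apply: hC gt; apply: dg; rewrite t1 (le_trans _ t0t)// ltW.
  have E : u' = (u + t *: h) + (1 - t) *: h.
    by rewrite scalerBl scale1r addrACA addrN addr0 /h addrC subrK.
  have := ler_normD (u + t *: h) ((1 - t) *: h).
  by rewrite -E normrZ ger0_norm ?subr_ge0//; lra.
have hn0 : 0 < `|h| by rewrite normr_gt0.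
have supS : has_sup S.
  by split; [exists t0; split => //; rewrite lexx|exists 1 => t [/andP[]]].
(* By [Sgap], this bounds the increment [la * (1 - t)] from below on all of [S], so a point of [S]
   this close to the supremum is carried past it. *)
have e0 : 0 < la * ((`|u'| - C) / `|h|).
  by case/andP: la01 => la0 _; rewrite mulr_gt0// divr_gt0// subr_gt0.
have [t St tsup] := sup_adherent e0 supS.
have := ub_le_sup supS.2 (Snext _ St).
have := Sgap _ St; rewrite -ler_pdivrMr// => /(ler_wpM2l (ltW (andP la01).1)).
move: tsup; lra.
Qed.

End ConvexSegments.

(** * Power-type recursions and their decay *)

Section PowerRecursion.
Variable R : realType.

(** The constant is fixed before [r] and [D], so a single [a] serves all iterates once their gaps
    share the bound [r0]. *)
Lemma gap_power_bound (p K r0 : R) : 1 < p -> 0 <= K -> 0 <= r0 ->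
  exists2 a : R, 0 < a & forall r D : R, 0 <= r <= r0 ->
    (forall t, 0 <= t <= 1 -> t * r - t `^ p * K <= D) ->
    a * r `^ (p - 1)^-1 * r <= D.
Proof.
move=> p1 K0 r00.
have p10 : 0 < p - 1 by rewrite subr_gt0.
have p0 : 0 < p by rewrite (lt_trans _ p1).
set s := (p - 1)^-1; have s0 : 0 < s by rewrite invr_gt0.
have sp : s * (p - 1) = 1 by rewrite mulVf// gt_eqF.
(* [t = r^s / A] makes [t^p K <= t r / 2], and [A] also ensures [t <= 1]. *)
pose A := 1 + r0 `^ s + (2 * K) `^ s.
have A0 : 0 < A.
  by rewrite /A; have := powR_ge0 r0 s; have := powR_ge0 (2 * K) s; lra.
exists ((2 * A)^-1); first by rewrite invr_gt0 mulr_gt0.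
move=> r D /andP[r0' rr0] hD.
pose t := r `^ s / A.
have t0 : 0 <= t by rewrite divr_ge0 ?powR_ge0// ltW.
have t1 : t <= 1.
  rewrite ler_pdivrMr// mul1r.
  have : r `^ s <= r0 `^ s by rewrite ge0_ler_powR ?nnegrE ?(ltW s0).
  by have := powR_ge0 (2 * K) s; rewrite /A; lra.
have tpK : t `^ (p - 1) * K <= r / 2.
  rewrite powRM ?powR_ge0 ?invr_ge0 ?(ltW A0)// -powRrM sp powRr1//.
  rewrite -(powR_inv1 (ltW A0)) powRAC powR_inv1 ?powR_ge0//.
  have Ap0 : 0 < A `^ (p - 1) by rewrite powR_gt0.
  rewrite -mulrA ler_wpM2l// mulrC ler_pdivrMr// mulrC ler_pdivlMr// mulrC.
  have -> : 2 * K = ((2 * K) `^ s) `^ (p - 1) by rewrite -powRrM sp powRr1 ?mulr_ge0.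
  rewrite ge0_ler_powR ?nnegrE ?powR_ge0 ?(ltW A0) ?(ltW p10)//.
  by have := powR_ge0 r0 s; rewrite /A; lra.
apply: le_trans (hD t _); last by rewrite t0.
have -> : (2 * A)^-1 * r `^ s * r = t * (r / 2).
  by rewrite /t; field; rewrite gt_eqF.
rewrite -(mulr_powRB1 t0 p0) -mulrA -mulrBr ler_wpM2l//.
by move: tpK; lra.
Qed.

Lemma power_recursion_bound (r : nat -> R) (a s : R) : 0 < a -> 1 <= s ->
  (forall n, 0 <= r n) -> (forall n, r n.+1 <= r n - a * r n `^ s * r n) ->
  forall n, n%:R * (a * r n `^ s) <= 1.
Proof.
(* [y_n = a r_n^s] satisfies [y_{n+1} <= y_n (1 - y_n)]. *)
move=> a0 s1 r0 hr; elim=> [|n IH]; first by rewrite mul0r.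
have s0 : 0 < s by rewrite (lt_le_trans ltr01).
have y0 : 0 <= a * r n `^ s by rewrite mulr_ge0 ?powR_ge0// ltW.
have z0 : 0 <= a * r n.+1 `^ s by rewrite mulr_ge0 ?powR_ge0// ltW.
(* A zero successor settles the claim, as [0^s = 0]; a positive one forces [y < 1], so that powers
   of [1 - y] can be estimated. *)
have [rn1|rn1] := eqVneq (r n.+1) 0.
  by rewrite rn1 powR0 ?gt_eqF// !mulr0.
have rn1p : 0 < r n.+1 by rewrite lt_def rn1 r0.
have rnp : 0 < r n.
  rewrite lt_def r0 andbT; apply/eqP => rn0.
  by have := hr n; rewrite rn0 mulr0 subr0 leNgt rn1p.
set y := a * r n `^ s in IH y0 *.
have y1 : y < 1.
  have : 0 < r n * (1 - y).
    by apply: lt_le_trans rn1p _; rewrite mulrBr mulr1 (mulrC _ y); exact: hr.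
  by rewrite pmulr_rgt0// subr_gt0.
have : a * r n.+1 `^ s <= y * (1 - y).
  have : r n.+1 `^ s <= (r n * (1 - y)) `^ s.
    rewrite ge0_ler_powR ?nnegrE ?(ltW s0)// ?mulr_ge0 ?subr_ge0 ?(ltW y1)//.
    by rewrite mulrBr mulr1 (mulrC _ y); exact: hr.
  rewrite powRM// ?subr_ge0 ?(ltW y1)//.
  have : (1 - y) `^ s <= 1 - y by apply: ge1r_powR; rewrite // subr_gt0 y1 lerBlDr lerDl.
  move=> /(ler_wpM2l (powR_ge0 (r n) s)) h1 h2.
  have := ler_wpM2l (ltW a0) (le_trans h2 h1).
  by rewrite mulrA.
move=> /(ler_wpM2l (ler0n R n.+1)) /le_trans; apply.
rewrite -natr1.
(* This expression equals [1 - (n + 1) y (1 - y)]; its first summand is nonnegative by the induction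
   hypothesis. *)
suff : 0 <= (1 - n%:R * y) * (1 - y) + y * y by lra.
by apply: addr_ge0; apply: mulr_ge0; rewrite ?subr_ge0 ?(ltW y1).
Qed.

Lemma powR_nat_cvg0 (b : R) : b < 0 -> n%:R `^ b @[n --> \oo] --> (0 : R).
Proof.
move=> b0.
have nb0 : 0 < - b by rewrite oppr_gt0.
(* The shift skips [n = 0] and leaves positive powers of the harmonic sequence. *)
rewrite -(cvg_shiftS (fun n => n%:R `^ b)).
have -> : (fun n => n.+1%:R `^ b) = (fun n : nat => (n.+1%:R^-1 : R) `^ (- b)).
  by apply/funext => n; rewrite -powR_inv1// -powRrM mulN1r opprK.
have /cvg_at_rightP := powR_cvg0 nb0.
apply; split; first by move=> n; rewrite invr_gt0.
exact: cvg_harmonic.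
Qed.

End PowerRecursion.

(** * Application to the extended-valued objective *)

Section Splitting.
Variables (R : realType) (X : normedModType R).
Variables (F : X -> R) (dF : X -> dual X) (Phi : X -> \bar R).
Variable (hF : proper_convex_lsc (EFin \o F)).
Variable (hPhi : proper_convex_lsc Phi).
Variable (hdF : forall u : X, is_diff u (F : X -> R^o) (dF u)).

Let dom := [set x | (Phi x < +oo)%E].
(** [fine] sends [+oo] to 0, so [phi] and [J] are meaningful only on [dom]. *)
Let phi := fine \o Phi.
Let J x := F x + phi x.

Lemma fine_domK x : dom x -> Phi x = (phi x)%:E.
Proof.
have [[lb _] _ _] := hPhi.
by move=> dx; rewrite /phi/= fineK// fin_real// lb.
Qed.

Lemma objective_domE x : dom x -> objective F Phi x = (J x)%:E.
Proof. by move=> dx; rewrite /objective fine_domK. Qed.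

Lemma objective_lty x : (objective F Phi x < +oo)%E -> dom x.
Proof.
by rewrite /dom /objective/=; case: (Phi x) => [y _||_]; rewrite ?ltry// addey.
Qed.

Lemma segmentE (x y : X) (t : R) : x + t *: (y - x) = t *: y + (1 - t) *: x.
Proof. by rewrite scalerBr scalerBl scale1r addrCA. Qed.

Lemma segment_convex_smooth : segment_convex setT F.
Proof.
have [_ cF _] := hF; move=> x y t _ _ t01; split => //.
have := cF y x t t01.
rewrite -segmentE -!EFinM -EFinD lee_fin; lra.
Qed.

Lemma segment_convex_fine : segment_convex dom phi.
Proof.
have [[lb _] cP _] := hPhi; move=> x y t dx dy t01.
have := cP y x t t01.
rewrite -segmentE (fine_domK dx) (fine_domK dy) -!EFinM -EFinD => le.
have ds : dom (x + t *: (y - x)) by exact: le_lt_trans le (ltry _).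
by split => //; move: le; rewrite fine_domK// lee_fin; lra.
Qed.

Lemma minimizer_dom x ustar : dom x -> minimizer (objective F Phi) ustar ->
  dom ustar.
Proof.
move=> dx hmin; apply: objective_lty; apply: le_lt_trans (hmin x) _.
by rewrite objective_domE// ltry.
Qed.

Lemma minimizer_le v ustar : dom v -> minimizer (objective F Phi) ustar ->
  J ustar <= J v.
Proof.
move=> dv hmin; have du := minimizer_dom dv hmin.
by have := hmin v; rewrite !objective_domE// lee_fin.
Qed.

(** On the segment from [ustar] to [v], minimality and convexity of [Phi] bound the slopes of [F]
    below by [Phi ustar - Phi v]; the limit at [ustar] is the subgradient inequality. *)
Lemma minimizer_subdifferential ustar : dom ustar ->
  minimizer (objective F Phi) ustar -> subdifferential Phi ustar (- dF ustar).
Proof.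
move=> du hmin v.
have -> : (- dF ustar) (v - ustar) = - (dF ustar (v - ustar)) by [].
have [dv|] := boolP (Phi v < +oo)%E; last by rewrite -leNgt leye_eq => /eqP->; rewrite leey.
rewrite (fine_domK du) (fine_domK dv) -EFinD lee_fin lerBlDr -lerBlDl.
apply: (slope_ge_derive (diff_is_derive (v - ustar) (hdF ustar))) => t /andP[t0 t1].
have t01 : 0 <= t <= 1 by rewrite ltW.
have [ds ps] := segment_convex_fine du dv t01.
by have := minimizer_le ds hmin; move: ps; rewrite /J; lra.
Qed.

(** [M] stays arbitrary: the rate takes a bound on the iterates, uniqueness the distance to a rival
    minimizer. *)
Lemma q_convex_growth q ustar M : dom ustar ->
  minimizer (objective F Phi) ustar -> q_convex q Phi ustar -> 0 < M ->
  exists2 c : R, 0 < c & forall v, dom v -> `|v - ustar| <= M ->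
    c * `|v - ustar| `^ q <= J v - J ustar.
Proof.
move=> du hmin hq M0.
have [c c0 hc] := hq _ _ M0 (minimizer_subdifferential du hmin).
exists c => // v dv vM; have := hc v vM.
have -> : (- dF ustar) (v - ustar) = - (dF ustar (v - ustar)) by [].
rewrite (fine_domK du) (fine_domK dv) -!EFinB lee_fin.
by have := convex_gradient_le v segment_convex_smooth (hdF ustar); rewrite /J; lra.
Qed.

(** The varying step size and Hoelder constant disappear here: replacing [tau] by [tau_min] only
    weakens the gap estimate and makes it uniform over the steps. *)
Lemma fb_step_estimates p delta tau_min u u' :
  1 < p -> 0 < delta < 1 -> 0 < tau_min -> dom u ->
  fb_step F dF Phi p delta tau_min u u' ->
  dom u' /\ exists2 D, J u' <= J u - delta * D &
    forall v t, dom v -> 0 <= t <= 1 ->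
      t * (J u - J v) - t `^ p * (`|v - u| `^ p / (p * tau_min)) <= D.
Proof.
move=> p1 delta01 taum0 du [L [C [tau [L0 hC hL /andP[taum tauL] [hmin _]]]]].
have p0 : 0 < p by rewrite (lt_trans _ p1).
have tau0 : 0 < tau by exact: lt_le_trans taum.
have proxE v : dom v -> prox_objective Phi p tau (dF u) u v =
    (`|v - u| `^ p / p + tau * (dF u v + phi v))%:E.
  by move=> dv; rewrite /prox_objective fine_domK.
(* The prox objective is finite at [u], whereas [tau > 0] would carry an infinite [Phi u'] over to
   its value at [u']. *)
have du' : dom u'.
  have := hmin u; rewrite (proxE u)// /prox_objective /dom/=.
  case: (Phi u') => [y _||_]; [exact: ltry| |by []].
  by rewrite addey// gt0_muley ?lte_fin// addey.
have hmin' v : dom v -> `|u' - u| `^ p / p + tau * (dF u u' + phi u') <=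
                      `|v - u| `^ p / p + tau * (dF u v + phi v).
  by move=> dv; have := hmin v; rewrite !proxE// lee_fin.
split=> //; exists (phi u - phi u' - dF u (u' - u)).
  apply: (fb_descent segment_convex_smooth hdF segment_convex_fine p1 tau0 L0
    delta01 tauL du du' hL).
    move=> v dv le; apply: hC; rewrite !objective_domE// lee_fin; exact: le.
  exact: (prox_sufficient_decrease segment_convex_fine p1 tau0 du du' hmin').
move=> v t dv t01.
have := prox_gap segment_convex_fine p1 tau0 du dv hmin' t01.
apply: le_trans; have /andP[t0 _] := t01.
apply: lerB.
  apply: ler_wpM2l => //.
  by have := convex_gradient_le v segment_convex_smooth (hdF u); rewrite /J; lra.
rewrite ler_wpM2l ?powR_ge0// ler_wpM2l ?powR_ge0// lef_pV2 ?posrE ?mulr_gt0//.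
by rewrite ler_pM2l.
Qed.

Lemma fb_energy_decay p delta tau_min (u : nat -> X) ustar :
  coercive (objective F Phi) -> 1 < p <= 2 -> 0 < delta < 1 -> 0 < tau_min ->
  fb_sequence F dF Phi p delta tau_min u ->
  minimizer (objective F Phi) ustar ->
  [/\ dom ustar, forall n, dom (u n),
      exists2 M : R, 0 < M & forall n, `|u n - ustar| <= M &
      exists2 a : R, 0 < a & forall n,
        n%:R * (a * (J (u n) - J ustar) `^ (p - 1)^-1) <= 1].
Proof.
move=> hcoer /andP[p1 p2] delta01 taum0 [du0 hu] hmin.
have p0 : 0 < p by rewrite (lt_trans _ p1).
have p10 : 0 < p - 1 by rewrite subr_gt0.
have dstar : dom ustar by exact: minimizer_dom du0 hmin.
have du n : dom (u n).
  elim: n => [//|n IH]; have [h|[_ ->//]] := hu n.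
  by have [] := fb_step_estimates p1 delta01 taum0 IH h.
pose r n := J (u n) - J ustar.
have r0 n : 0 <= r n by rewrite subr_ge0 minimizer_le.
have step n : exists2 D, r n.+1 <= r n - delta * D &
    forall t, 0 <= t <= 1 -> t * r n -
      t `^ p * (`|ustar - u n| `^ p / (p * tau_min)) <= D.
  have [h|[hn un]] := hu n.
    have [_ [D D1 D2]] := fb_step_estimates p1 delta01 taum0 (du n) h.
    exists D; first by rewrite /r; move: D1; lra.
    by move=> t t01; exact: D2.
  (* After stopping the gap is 0, and [D = 0] serves. *)
  have rn0 : r n = 0.
    by apply/eqP; rewrite eq_le r0 andbT subr_le0 minimizer_le.
  exists 0; first by rewrite /r un mulr0 subr0.
  move=> t t01; rewrite rn0 mulr0 add0r oppr_le0.
  by rewrite mulr_ge0 ?powR_ge0// divr_ge0 ?powR_ge0// mulr_ge0 ?ltW.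
have rS n : r n.+1 <= r n.
  (* The choice [t = 0] gives [D >= 0], hence monotone energy. *)
  have [D D1 /(_ 0)] := step n; rewrite lexx ler01 mul0r powR0 ?gt_eqF// mul0r subr0.
  move=> /(_ isT) D0; apply: le_trans D1 _; rewrite gerBl mulr_ge0//.
  by case/andP: delta01 => /ltW.
have rle n : r n <= r 0%N by elim: n => [//|n]; exact: le_trans.
(* The margin 1 makes the comparison strict: an iterate of norm at least [B] would have energy above
   [J (u 0)]. *)
have [B hB] := hcoer (J (u 0%N) + 1).
have uB n : `|u n| <= `|B|.
  apply: le_trans (ler_norm _); rewrite leNgt; apply/negP => /ltW /hB.
  rewrite objective_domE// lee_fin; have := rle n; rewrite /r; lra.
pose M := `|B| + `|ustar| + 1.
have M0 : 0 < M by rewrite /M; have := normr_ge0 B; have := normr_ge0 ustar; lra.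
have uM n : `|u n - ustar| <= M.
  by have := ler_normB (u n) ustar; have := uB n; rewrite /M; lra.
split=> //; first by exists M.
have K0 : 0 <= M `^ p / (p * tau_min).
  by rewrite divr_ge0 ?powR_ge0// mulr_ge0 ?ltW.
have [a a0 ha] := gap_power_bound p1 K0 (r0 0%N).
have /andP[delta0 _] := delta01.
exists (delta * a); first by rewrite mulr_gt0.
apply: (@power_recursion_bound _ r) => //; first by rewrite mulr_gt0.
  (* [p <= 2] enters here, as [1 / (p - 1) >= 1]. *)
  by rewrite invf_ge1//; lra.
move=> n; have [D D1 D2] := step n.
apply: le_trans D1 _; rewrite lerB// -!mulrA ler_pM2l// mulrA.
apply: ha; first by rewrite r0 rle.
move=> t t01; apply: le_trans (D2 t t01); rewrite lerB//.
rewrite ler_wpM2l ?powR_ge0// ler_wpM2r ?invr_ge0 ?mulr_ge0 ?(ltW p0) ?(ltW taum0)//.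
by rewrite ge0_ler_powR ?nnegrE ?(ltW p0) ?(ltW M0)// distrC.
Qed.

End Splitting.

(** * Uniqueness of the minimizer and convergence rate *)

Theorem theorem2 (R : realType) (X : completeNormedModType R)
  (hX : reflexive_space X)
  (F : X -> R) (dF : X -> dual X) (Phi : X -> \bar R)
  (hF : proper_convex_lsc (EFin \o F))
  (hPhi : proper_convex_lsc Phi)
  (hcoer : coercive (objective F Phi))
  (hdF : forall u : X, is_diff u (F : X -> R^o) (dF u))
  (p : R) (hp : 1 < p <= 2)
  (hholder : forall r : R, 0 < r ->
    exists2 L : R, 0 < L & holder_on_ball dF (p - 1) L r)
  (delta tau_min : R) (hdelta : 0 < delta < 1) (htau : 0 < tau_min)
  (u : nat -> X) (hu : fb_sequence F dF Phi p delta tau_min u)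
  (ustar : X) (hustar : minimizer (objective F Phi) ustar)
  (q : R) (hq : 2 <= q) (hPhiq : q_convex q Phi ustar) :
  [/\ forall v : X, minimizer (objective F Phi) v -> v = ustar,
      u n @[n --> \oo] --> ustar &
      exists2 C : R, 0 < C &
        forall n : nat, (1 <= n)%N -> `|u n - ustar| <= C * n%:R `^ ((1 - p) / q)].
Proof.
have [dstar du [M M0 uM] [a a0 hdecay]] :=
  fb_energy_decay hF hPhi hdF hcoer hp hdelta htau hu hustar.
have /andP[p1 _] := hp.
have p10 : 0 < p - 1 by rewrite subr_gt0.
have q0 : 0 < q by rewrite (lt_le_trans _ hq).
have growth := q_convex_growth hF hPhi hdF dstar hustar hPhiq.
have uniq_min v : minimizer (objective F Phi) v -> v = ustar.
  move=> hv; have dv := minimizer_dom hPhi dstar hv.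
  (* Adding 1 keeps the radius positive even when [v = ustar]. *)
  have M'0 : 0 < `|v - ustar| + 1 by rewrite ltr_wpDl.
  have [c c0 hc] := growth _ M'0.
  have := hc v dv; rewrite lerDl ler01 => /(_ isT) h.
  have : c * `|v - ustar| `^ q <= 0.
    apply: le_trans h _; rewrite subr_le0; exact: (minimizer_le hPhi).
  rewrite pmulr_rle0// => h0; apply/eqP; rewrite -subr_eq0 -normr_eq0.
  have : `|v - ustar| `^ q == 0 by rewrite eq_le h0 powR_ge0.
  by rewrite powR_eq0 => /andP[].
have [c c0 hc] := growth _ M0.
(* Obtained by taking [q]-th roots in [c |u_n - ustar|^q <= r_n <= (a n)^(1 - p)]. *)
pose C := c^-1 `^ q^-1 * a^-1 `^ ((p - 1) / q).
have C0 : 0 < C by rewrite mulr_gt0 ?powR_gt0 ?invr_gt0.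
have rate n : (1 <= n)%N -> `|u n - ustar| <= C * n%:R `^ ((1 - p) / q).
  move=> n1; have n0 : 0 < n%:R :> R by rewrite ltr0n.
  have := hc (u n) (du n) (uM n); have := hdecay n.
  set r := (X in X `^ _) => hr hd.
  have r0 : 0 <= r by apply: le_trans hd; rewrite mulr_ge0 ?powR_ge0// ltW.
  have rle : r <= (a^-1 * n%:R^-1) `^ (p - 1).
    have -> : r = (r `^ (p - 1)^-1) `^ (p - 1).
      by rewrite -powRrM mulVf ?gt_eqF// powRr1.
    rewrite ge0_ler_powR ?nnegrE ?powR_ge0 ?(ltW p10)//.
      by rewrite mulr_ge0// invr_ge0 ltW.
    by rewrite ler_pdivlMr// -[a^-1]mulr1 ler_pdivlMl// mulrA mulrC.
  have -> : `|u n - ustar| = (`|u n - ustar| `^ q) `^ q^-1.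
    by rewrite -powRrM mulfV ?gt_eqF// powRr1.
  have -> : C * n%:R `^ ((1 - p) / q) = (c^-1 * (a^-1 * n%:R^-1) `^ (p - 1)) `^ q^-1.
    rewrite /C powRM ?invr_ge0 ?(ltW c0) ?powR_ge0// -powRrM powRM ?invr_ge0 ?(ltW a0) ?(ltW n0)//.
    by rewrite mulrA -(powR_inv1 (ltW n0)) -(powRrM n%:R) mulrA mulN1r opprB.
  rewrite ge0_ler_powR ?nnegrE ?powR_ge0 ?invr_ge0 ?(ltW q0)//.
    by rewrite mulr_ge0 ?powR_ge0// invr_ge0 ltW.
  by rewrite ler_pdivlMl//; exact: le_trans hd rle.
split=> //; last by exists C.
apply/subr_cvg0/norm_cvg0P.
have expn_lt0 : (1 - p) / q < 0 by rewrite pmulr_llt0 ?invr_gt0// subr_lt0.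
apply: (@squeeze_cvgr _ _ _ _ (cst 0) (fun n => C * n%:R `^ ((1 - p) / q))).
- by near=> n; rewrite normr_ge0 rate//; near: n; exact: nbhs_infty_ge.
- exact: cvg_cst.
- rewrite -[X in _ --> X](mulr0 C).
  by apply: cvgM; [exact: cvg_cst|exact: powR_nat_cvg0].
Unshelve. all: by end_near.
Qed.
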